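(* Let $k\geq 1$ be an integer and let $m$ be the smallest integer such that $\binom{m}{2} \geq 2k$ if $k$ is odd, and $\binom{m}{2}\geq 2k+1$ if $k$ is even. Then $2 < \mathrm{Dist}(\Omega_{2k}) \leq m$.
   Context: The orthogonality graph $\Omega_{2k}$ has vertex set $\mathbb{Z}_2^{2k}$ (bitstrings of length $2k$), with two vertices adjacent if and only if their bitstrings differ in exactly $k$ positions. A labeling $f: V(G)\to\{1,\dots,d\}$ of a graph $G$ is $d$-distinguishing if the only automorphism of $G$ preserving every label class is the identity; $\mathrm{Dist}(G)$ is the least $d$ for which $G$ has a $d$-distinguishing labeling. *)

(* Defs.v *)
From mathcomp Require Import all_boot all_order all_fingroup all_algebra.

Set Implicit Arguments.
Unset Strict Implicit.
Unset Printing Implicit Defensive.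

Section Distinguishing.
Variables (T : finType) (e : rel T).

Definition automorphism (s : {perm T}) : bool :=
  [forall x, forall y, e (s x) (s y) == e x y].

(* The label set {1, ..., d} is represented by 'I_d = {0, ..., d - 1}. *)
Definition distinguishing d (f : {ffun T -> 'I_d}) : bool :=
  [forall s : {perm T},
    automorphism s && [forall x, f (s x) == f x] ==> (s == 1%g)].

Definition distinguishable d : bool :=
  [exists f : {ffun T -> 'I_d}, distinguishing f].

Lemma distinguishable_card : distinguishable #|T|.
Proof.
apply/existsP; exists [ffun x => enum_rank x].
apply/forallP => s; apply/implyP => /andP[_ /forallP fs].
apply/eqP/permP => x; rewrite perm1.
by have /eqP := fs x; rewrite !ffunE => /enum_rank_inj.
Qed.

Definition Dist : nat :=
  ex_minn (ex_intro (fun d => distinguishable d) #|T| distinguishable_card).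

End Distinguishing.

Definition hamming n (x y : 'rV['Z_2]_n) : nat :=
  #|[set i | x ord0 i != y ord0 i]|.

Definition Omega k : rel 'rV['Z_2]_(2 * k) := fun x y => hamming x y == k.
Arguments Omega k x y : clear implicits.

Lemma Omega_sym k : symmetric (Omega k).
Proof.
by move=> x y; congr (_ == _); apply: eq_card => i; rewrite !inE eq_sym.
Qed.

(* Fails for k = 0, where every vertex would carry a loop. *)
Lemma Omega_irreflexive k : 0 < k -> irreflexive (Omega k).
Proof.
move=> k_gt0 x; apply/negbTE; rewrite /Omega /hamming.
rewrite (_ : [set _ | _] = set0) ?cards0 ?ltn_eqF //.
by apply/setP => i; rewrite !inE eqxx.
Qed.

Definition threshold k : nat := if odd k then 2 * k else (2 * k).+1.

(* Main.v *)
(** Fix a coordinate [l]. A vector is determined up to its antipode by the set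
    [fold l x] of coordinates at which it differs from its [l]-th one, and [x],
    [y] are adjacent iff the symmetric difference of their folds has size [k].

    If [x] and [y] are at distance [2 j] they have
    ['C(2 j, j) * 'C(2 (k - j), k - j)] common neighbours, and none if the
    distance is odd. This number is strictly decreasing for [2 j <= k], so
    automorphisms preserve the parity of the distance, and even distances up to
    [d <-> 2 k - d].

    Upper bound. Colour the antipodal pairs: the even fold [[set~ l] :\ i] and
    the odd fold [[set i]] get colour [i], all others get a spare colour. The
    even distances to the privately coloured pairs determine a vertex up to its
    antipode, except that for [k] odd the even folds of size [0] and [k - 1] need
    not be separated from one another. Those are separated by adjacency to the
    folds [[set i]], and odd folds are then determined by their neighbours. For
    [k] even there is one spare colour for each parity; for [k] odd a single one
    suffices if one odd fold [[set l1]] is deprived of its private colour, so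
    that the colouring still tells the parities apart. A colour is realised as
    an unordered pair of labels, one for each of the two antipodes.

    Lower bound. Antipodes are twins, hence carry different labels; with two
    labels, a translation followed by suitable antipodal swaps preserves them. *)
Require Import Defs.
From mathcomp Require Import all_boot all_order all_fingroup all_algebra.
From mathcomp Require Import zify.

Set Implicit Arguments.
Unset Strict Implicit.
Unset Printing Implicit Defensive.

Import GRing.Theory.

(** * Monotonicity of products of central binomial coefficients *)

Lemma central_binS j : j.+1 * 'C(2 * j.+1, j.+1) = 2 * (2 * j).+1 * 'C(2 * j, j).
Proof.
have ebin : 'C(2 * j.+1, j.+1) = 2 * 'C((2 * j).+1, j).
  rewrite mulnS add2n binS [RHS]mul2n -addnn; congr addn.
  by rewrite -[in LHS]bin_sub; [congr 'C(_, _); lia | lia].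
have e2 : j.+1 * 'C((2 * j).+1, j) = (2 * j).+1 * 'C(2 * j, j).
  have := mul_bin_left (2 * j).+1 j; have := mul_bin_diag (2 * j).+1 j.
  by rewrite /=; nia.
by rewrite ebin; nia.
Qed.

(** By the recurrence, passing from [j] to [j.+1] multiplies ['C(2 * j, j)] by 4 - 2 / (j + 1),
    which increases with [j]; moving a unit from the larger index to the smaller thus loses more
    than it gains. *)
Lemma central_bin_prod_ltn j l : j.+1 < l ->
  'C(2 * j.+1, j.+1) * 'C(2 * l.-1, l.-1) < 'C(2 * j, j) * 'C(2 * l, l).
Proof.
case: l => // l /=; rewrite ltnS => jl.
have := central_binS j; have := central_binS l.
have : 0 < 'C(2 * j, j) by rewrite bin_gt0; lia.
have : 0 < 'C(2 * l, l) by rewrite bin_gt0; lia.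
move: ('C(2 * j, j)) ('C(2 * l, l)) ('C(2 * j.+1, _)) ('C(2 * l.+1, _)).
move=> a b a' b' b0 a0 eb ea.
have lt : 2 * (2 * j).+1 * l.+1 < 2 * (2 * l).+1 * j.+1 by nia.
have ab0 : 0 < a * b by rewrite muln_gt0 a0.
rewrite -(ltn_pmul2l (m := j.+1 * l.+1)) //.
have -> : j.+1 * l.+1 * (a' * b) = 2 * (2 * j).+1 * l.+1 * (a * b).
  by rewrite mulnACA ea; lia.
have -> : j.+1 * l.+1 * (a * b') = 2 * (2 * l).+1 * j.+1 * (a * b).
  by rewrite mulnACA eb; lia.
by rewrite ltn_pmul2r.
Qed.

Lemma central_bin_prod_decr k i j : i < j -> 2 * j <= k ->
  'C(2 * j, j) * 'C(2 * (k - j), k - j) < 'C(2 * i, i) * 'C(2 * (k - i), k - i).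
Proof.
elim: j => // j IH; rewrite ltnS => ij jk.
have lt := @central_bin_prod_ltn j (k - j).
have {lt} := lt _; rewrite -subnS => /(_ ltac:(lia)) lt.
case: (ltngtP i j) ij => // [ij _|-> //].
by apply: (ltn_trans lt); apply: IH => //; lia.
Qed.

Lemma central_bin_prod_inj k i j : i <= k -> j <= k ->
  'C(2 * i, i) * 'C(2 * (k - i), k - i) = 'C(2 * j, j) * 'C(2 * (k - j), k - j) ->
  i = j \/ i = k - j.
Proof.
pose g i := 'C(2 * i, i) * 'C(2 * (k - i), k - i).
have gC a : a <= k -> g (k - a) = g a by move=> ?; rewrite /g subKn // mulnC.
have g_inj a b : 2 * a <= k -> 2 * b <= k -> g a = g b -> a = b.
  move=> ak bk e; case: (ltngtP a b) => // ab.
  - by have := central_bin_prod_decr ab bk; rewrite -/(g a) -/(g b) e ltnn.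
  - by have := central_bin_prod_decr ab ak; rewrite -/(g a) -/(g b) e ltnn.
rewrite -/(g i) -/(g j) => ik jk.
(* An index in the upper half is first reflected to the lower half, where the product is strictly
   decreasing. *)
case: (leqP (2 * i) k) => hi; case: (leqP (2 * j) k) => hj.
- by move/g_inj => ?; lia.
- by rewrite -(gC j) // => /g_inj; lia.
- by rewrite -(gC i) // => /g_inj; lia.
- by rewrite -(gC i) // -(gC j) // => /g_inj; lia.
Qed.

(** * Symmetric differences, and sets determined by distances *)

Section SymmetricDifference.
Variable T : finType.
Implicit Types A B C D W : {set T}.

Definition symdiff A B := [set i | (i \in A) (+) (i \in B)].

Lemma in_symdiff A B i : (i \in symdiff A B) = (i \in A) (+) (i \in B).
Proof. by rewrite inE. Qed.

Lemma card_symdiff A B : #|symdiff A B| = #|A :\: B| + #|B :\: A|.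
Proof.
rewrite -cardsUI (_ : _ :&: _ = set0) ?cards0 ?addn0; last first.
  by apply/setP => i; rewrite !inE; case: (i \in A); case: (i \in B).
by apply: eq_card => i; rewrite !inE; case: (i \in A); case: (i \in B).
Qed.

Lemma card_symdiff1 A i : #|symdiff A [set i]| = if i \in A then #|A|.-1 else #|A|.+1.
Proof.
rewrite card_symdiff; case: ifP => iA.
  rewrite (eqP (_ : [set i] :\: A == set0)) ?setD_eq0 ?sub1set //.
  by rewrite cards0 addn0 (cardsD1 i A) iA.
have dis : [disjoint A & [set i]] by rewrite disjoint_sym disjoints1 iA.
by rewrite !(setDidPl _) // ?cards1 ?addn1 // disjoint_sym.
Qed.

Lemma card_split_draws D a b :
  #|[set W : {set T} | (#|W :&: D| == a) && (#|W :\: D| == b)]|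
  = 'C(#|D|, a) * 'C(#|T| - #|D|, b).
Proof.
have cD : #|~: D| = #|T| - #|D| by rewrite -(cardsC D); lia.
have split_union (P Q : {set T}) : P \subset D -> Q \subset ~: D ->
    (P :|: Q) :&: D = P /\ (P :|: Q) :\: D = Q.
  move=> PD QD; have QD0 : Q :&: D = set0.
    by apply/eqP; rewrite setI_eq0 disjoints_subset.
  rewrite setIUl setDUl (setIidPl PD) QD0 setU0 (eqP (_ : P :\: D == set0)) ?setD_eq0 //.
  by rewrite set0U; split=> //; apply/setDidPl; rewrite -setI_eq0 QD0.
rewrite -cD -(cards_draws D) -(cards_draws (~: D)) -cardsX.
rewrite -(card_in_imset (f := fun u : {set T} * {set T} => u.1 :|: u.2)); last first.
  move=> [P Q] [P' Q']; rewrite !inE /= => /andP[/andP[PD _] /andP[QD _]].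
  move=> /andP[/andP[PD' _] /andP[QD' _]] e.
  have [eP eQ] := split_union _ _ PD QD; have [eP' eQ'] := split_union _ _ PD' QD'.
  by congr (_, _); [rewrite -eP e eP' | rewrite -eQ e eQ'].
apply: eq_card => W; rewrite inE; apply/idP/imsetP.
  move=> /andP[Wa Wb]; exists (W :&: D, W :\: D); last by rewrite /= setID.
  by rewrite !inE /= Wa Wb subsetIr setDE subsetIr.
move=> [[P Q]]; rewrite !inE /= => /andP[/andP[PD Pa] /andP[QD Qb]] ->.
by have [-> ->] := split_union _ _ PD QD; rewrite Pa Qb.
Qed.

(** Since |D + W| = |D| + |W| - 2 |W :&: D|, the two conditions force [W] to contain exactly half of
    [D]. *)
Lemma card_balanced_draws k D : #|T| = 2 * k ->
  #|[set W : {set T} | (#|W| == k) && (#|symdiff D W| == k)]|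
  = if odd #|D| then 0 else 'C(2 * #|D|./2, #|D|./2) * 'C(2 * (k - #|D|./2), k - #|D|./2).
Proof.
move=> cT; have leD : #|D| <= 2 * k by rewrite -cT max_card.
have cE W : (#|W| == k) && (#|symdiff D W| == k)
    = ~~ odd #|D| && ((#|W :&: D| == #|D|./2) && (#|W :\: D| == k - #|D|./2)).
  rewrite card_symdiff -(cardsID D W); have := cardsID W D; rewrite setIC; lia.
case: ifP => oD; rewrite oD /= in cE.
  by apply/eqP; rewrite cards_eq0; apply/eqP/setP=> W; rewrite !inE cE.
rewrite (_ : [set _ | _]
  = [set W | (#|W :&: D| == #|D|./2) && (#|W :\: D| == k - #|D|./2)]).
  by rewrite card_split_draws cT; congr ('C(_, _) * 'C(_, _)); lia.
by apply/setP => W; rewrite !inE cE.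
Qed.

(* The exceptional sizes are those for which the distance to [[set i]], up to
   [d <-> 2 k - d], does not depend on [i]. *)
Lemma resolved_by_singletons k l B C : #|T| = 2 * k -> l \notin B -> l \notin C ->
  odd #|B| -> odd #|C| ->
  (forall i, i != l -> #|symdiff C [set i]| = #|symdiff B [set i]| \/
                       #|symdiff C [set i]| = 2 * k - #|symdiff B [set i]|) ->
  B = C \/ [/\ odd k, #|B| = k \/ #|B| = (2 * k).-1 & #|C| = k \/ #|C| = (2 * k).-1].
Proof.
move=> cT lB lC oB oC dBC.
have leB : #|B| <= 2 * k by rewrite -cT max_card.
have cB := cardsID C B; have cC := cardsID B C; rewrite setIC in cC.
have cX : #|B :&: C| + #|B :\: C| + #|C :\: B| + #|~: (l |: (B :|: C))| = (2 * k).-1.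
  have := cardsC (l |: (B :|: C)); rewrite cardsU1 !inE negb_or lB lC cT /=.
  have := cardsUI B C; lia.
(* [B] and [C] cut the points other than [l] into four regions; a point in any one of them gives a
   linear alternative for [#|B|] and [#|C|]. The final [lia] combines these with the sizes of the
   regions. *)
have hp : 0 < #|B :&: C| -> #|C| = #|B| \/ #|C| + #|B| = 2 * k + 2.
  move/card_gt0P=> [i]; rewrite inE => /andP[iB iC].
  have il : i != l by apply: contraNneq lB => <-.
  by have := dBC i il; rewrite !card_symdiff1 iB iC; lia.
have hq : 0 < #|B :\: C| -> #|C| + 2 = #|B| \/ #|C| + #|B| = 2 * k.
  move/card_gt0P=> [i]; rewrite inE => /andP[/negbTE iC iB].
  have il : i != l by apply: contraNneq lB => <-.
  by have := dBC i il; rewrite !card_symdiff1 iB iC; lia.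
have hr : 0 < #|C :\: B| -> #|C| = #|B| + 2 \/ #|C| + #|B| = 2 * k.
  move/card_gt0P=> [i]; rewrite inE => /andP[/negbTE iB iC].
  have il : i != l by apply: contraNneq lC => <-.
  by have := dBC i il; rewrite !card_symdiff1 iB iC; lia.
have hs : 0 < #|~: (l |: (B :|: C))| -> #|C| = #|B| \/ #|C| + #|B| + 2 = 2 * k.
  move/card_gt0P=> [i]; rewrite !inE !negb_or => /and3P[il /negbTE iB /negbTE iC].
  by have := dBC i il; rewrite !card_symdiff1 iB iC; lia.
have [e|] := eqVneq B C; first by left.
move=> nBC; right.
have : 0 < #|B :\: C| + #|C :\: B|.
  rewrite -card_symdiff card_gt0; apply: contraNneq nBC => e.
  apply/eqP/setP => i; have : i \in symdiff B C = false by rewrite e inE.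
  by rewrite inE; case: (i \in B); case: (i \in C).
move: (#|B :&: C|) (#|B :\: C|) (#|C :\: B|) (#|~: _|) (#|B|) (#|C|)
  cB cC cX hp hq hr hs oB oC.
clear => p q r s b c *.
split; lia.
Qed.

Lemma card_symdiff_eq0 A B : (#|symdiff A B| == 0) = (A == B).
Proof.
rewrite cards_eq0; apply/eqP/eqP => [/setP e|->]; apply/setP => i.
  by have := e i; rewrite !inE; do 2!case: (i \in _).
by rewrite !inE addbb.
Qed.

Lemma odd_card_symdiff A B : odd #|symdiff A B| = odd #|A| (+) odd #|B|.
Proof.
rewrite card_symdiff -(cardsID B A) -(cardsID A B) setIC !oddD.
by rewrite addbACA addbb.
Qed.

(** Folds at [l] avoid [l], so this is the complement in the set where they live; in even dimension
    it exchanges even and odd folds. *)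
Definition setC_off l A := ~: (l |: A).

Lemma notin_setC_off l A : l \notin setC_off l A.
Proof. by rewrite !inE eqxx. Qed.

Lemma setC_offK l A : l \notin A -> setC_off l (setC_off l A) = A.
Proof.
move=> lA; apply/setP=> i; rewrite !inE; case: eqP => [->|]; last by rewrite negbK.
by rewrite (negbTE lA).
Qed.

Lemma card_setC_off l A : l \notin A -> #|setC_off l A| = (#|T| - #|A|).-1.
Proof. by move=> lA; rewrite cardsCs setCK cardsU1 lA; lia. Qed.

(** Distances from even folds to [setC_off l [set i]] become distances from odd folds to singletons,
    as [resolved_by_singletons] requires. *)
Lemma symdiff_setC_off l A i : l \notin A -> i != l ->
  symdiff A (setC_off l [set i]) = symdiff (setC_off l A) [set i].
Proof.
move=> /negbTE lA /negbTE il; apply/setP => j; rewrite !inE.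
case: (eqVneq j l) => [->|_]; first by rewrite lA eq_sym il.
by case: (j \in A); case: (_ == _).
Qed.

(** A set of size [k.-1] is adjacent to [[set i]] exactly when it misses [i], so two such sets can
    differ only at [l'], which parity forbids. For [1 < k] the empty set is adjacent to no
    singleton, unlike a set of size [k.-1]. *)
Lemma resolved_by_adjacency k l l' A B : #|T| = 2 * k -> odd k ->
  l \notin A -> l \notin B -> ~~ odd #|A| -> ~~ odd #|B| ->
  #|A| = 0 \/ #|A| = k.-1 -> #|B| = 0 \/ #|B| = k.-1 ->
  (forall i, i != l -> i != l' ->
     (#|symdiff A [set i]| == k) = (#|symdiff B [set i]| == k)) -> A = B.
Proof.
move=> cT k_odd lA lB oA oB cA cB adj.
have noempty (C D : {set T}) : l \notin D -> #|C| = 0 -> #|D| = k.-1 -> 1 < k ->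
    (forall i, i != l -> i != l' ->
     (#|symdiff C [set i]| == k) = (#|symdiff D [set i]| == k)) -> False.
  move=> lD cC cD k1 adj'.
  have : 0 < #|~: (l |: (l' |: D))|.
    have := cardsC (l |: (l' |: D)); rewrite !cardsU1 cT.
    by move: (~: _) (l \notin _) (l' \notin _) => X [] []; lia.
  case/card_gt0P => i; rewrite !inE !negb_or => /and3P[il il' iD].
  have := adj' i il il'; rewrite !card_symdiff1 (negbTE iD).
  by move/eqP: cC; rewrite cards_eq0 => /eqP ->; rewrite inE cards0 cD; lia.
have adjC i : i != l -> i != l' ->
    (#|symdiff B [set i]| == k) = (#|symdiff A [set i]| == k).
  by move=> il il'; rewrite adj.
have eAB : #|A| = #|B|.
  case: cA cB => [cA|cA] [cB|cB]; rewrite cA cB //.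
    case: (ltnP 1 k) => k1; last by lia.
    by case: (noempty A B).
  case: (ltnP 1 k) => k1; last by lia.
  by case: (noempty B A).
case: cA => cA.
  by rewrite (cards0_eq cA) (cards0_eq (etrans (esym eAB) cA)).
apply/eqP; rewrite -card_symdiff_eq0.
have : #|symdiff A B| <= #|[set l']|.
  apply/subset_leq_card/subsetP => i; rewrite !inE; apply: contraLR => il'.
  have [->|il] := eqVneq i l; first by rewrite (negbTE lA) (negbTE lB).
  have := adj i il il'; rewrite !card_symdiff1 -eAB cA.
  by case: (i \in A); case: (i \in B) => //; lia.
have := odd_card_symdiff A B; rewrite (negbTE oA) (negbTE oB) cards1; lia.
Qed.

End SymmetricDifference.

(** * Binary vectors and their folds *)

Section BinaryVectors.
Variable n : nat.
Implicit Types (x y z : 'rV['Z_2]_n) (l i : 'I_n).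

Definition antipode x : 'rV['Z_2]_n := (x + const_mx 1)%R.

(** Entries are handled through the boolean [a != 0], which turns addition and comparison into
    exclusive or. *)
Lemma Z2_neqE (a b : 'Z_2) : (a != b) = (a != 0%R) (+) (b != 0%R).
Proof. by case: a => [[|[|]]] // ?; case: b => [[|[|]]]. Qed.

Lemma Z2_add_neq0 (a b : 'Z_2) : (a + b != 0)%R = (a != 0%R) (+) (b != 0%R).
Proof. by case: a => [[|[|]]] // ?; case: b => [[|[|]]]. Qed.

Definition diffset x y := [set i | x ord0 i != y ord0 i].

Definition indicator (A : {set 'I_n}) : 'rV['Z_2]_n :=
  (\row_i if i \in A then 1 else 0)%R.

Lemma indicator_neq0 A i : (indicator A ord0 i != 0)%R = (i \in A).
Proof. by rewrite mxE; case: ifP. Qed.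

Lemma vector_ext x y : (forall i, (x ord0 i != 0)%R = (y ord0 i != 0)%R) -> x = y.
Proof.
move=> e; apply/rowP => i; apply/eqP; rewrite -[_ == _]negbK Z2_neqE e addbb //.
Qed.

Lemma antipode_neq x i : (antipode x ord0 i != 0)%R = ~~ (x ord0 i != 0%R).
Proof. by rewrite mxE Z2_add_neq0 mxE addbT. Qed.

Lemma antipodeK : involutive antipode.
Proof. by move=> x; apply: vector_ext => i; rewrite !antipode_neq !negbK. Qed.

Lemma antipode_translate x y : antipode (x + y)%R = (antipode x + y)%R.
Proof. by rewrite /antipode addrAC. Qed.

Definition fold l x := diffset x (const_mx (x ord0 l)).

Lemma in_fold l x i :
  (i \in fold l x) = (x ord0 i != 0%R) (+) (x ord0 l != 0%R).
Proof. by rewrite inE mxE Z2_neqE. Qed.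

Lemma notin_fold l x : l \notin fold l x.
Proof. by rewrite in_fold addbb. Qed.

Lemma fold_antipode l x : fold l (antipode x) = fold l x.
Proof. by apply/setP => i; rewrite !in_fold !antipode_neq addbN addNb negbK. Qed.

Lemma fold_inj l x y : fold l x = fold l y -> y = x \/ y = antipode x.
Proof.
move=> /setP e; have E i : (y ord0 i != 0)%R
    = (x ord0 i != 0)%R (+) ((x ord0 l != 0)%R (+) (y ord0 l != 0)%R).
  by move: (e i); rewrite !in_fold; do 4!case: (_ == _).
case exy: ((x ord0 l != 0)%R (+) (y ord0 l != 0)%R).
- by right; apply: vector_ext => i; rewrite E exy antipode_neq addbT.
- by left; apply: vector_ext => i; rewrite E exy addbF.
Qed.

Lemma antipode_neq_self l x : antipode x != x.
Proof.
apply/eqP => e; have := antipode_neq x l; rewrite e.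
by case: (_ == _).
Qed.

Lemma fold_indicator l (A : {set 'I_n}) : l \notin A -> fold l (indicator A) = A.
Proof.
by move=> /negbTE lA; apply/setP => i; rewrite in_fold !indicator_neq0 lA addbF.
Qed.

Lemma in_diffset x y i :
  (i \in diffset x y) = (x ord0 i != 0)%R (+) (y ord0 i != 0)%R.
Proof. by rewrite inE Z2_neqE. Qed.

Lemma diffset_fold l x y : diffset x y = symdiff (fold l x) (fold l y) \/
  diffset x y = ~: symdiff (fold l x) (fold l y).
Proof.
case e: ((x ord0 l != 0)%R (+) (y ord0 l != 0)%R); [right|left];
  apply/setP => i; rewrite in_diffset ?in_setC in_symdiff !in_fold; move: e;
  by do 4!case: (_ == _).
Qed.

Lemma hamming_fold l x y : hamming x y = #|symdiff (fold l x) (fold l y)| \/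
  hamming x y = n - #|symdiff (fold l x) (fold l y)|.
Proof.
have e : hamming x y = #|diffset x y| by [].
rewrite e; case: (diffset_fold l x y) => ->; [by left|right].
by rewrite cardsCs setCK card_ord.
Qed.

Lemma card_ord_le (A : {set 'I_n}) : #|A| <= n.
Proof. by rewrite -[leqRHS]card_ord max_card. Qed.

Lemma hamming_translate x y z : hamming (x + z)%R (y + z)%R = hamming x y.
Proof. by apply: eq_card => i; rewrite !inE !mxE (inj_eq (addIr _)). Qed.

End BinaryVectors.

(** * Common neighbours and the distances kept by automorphisms *)

Section Orthogonality.
Variable k : nat.
Local Notation V := 'rV['Z_2]_(2 * k).
Implicit Types x y z : V.
Implicit Type l : 'I_(2 * k).

(** The folds give the distance up to complementation in 2 k, which fixes [k]. *)
Lemma Omega_fold l x y : Omega k x y = (#|symdiff (fold l x) (fold l y)| == k).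
Proof.
have := card_ord_le (symdiff (fold l x) (fold l y)).
by rewrite /Omega; case: (hamming_fold l x y) => ->; move: #|_| => d; lia.
Qed.

Lemma common_neighbors x y :
  #|[set z | Omega k x z && Omega k y z]|
  = if odd (hamming x y) then 0
    else 'C(2 * (hamming x y)./2, (hamming x y)./2)
         * 'C(2 * (k - (hamming x y)./2), k - (hamming x y)./2).
Proof.
rewrite -(card_balanced_draws (diffset x y) (card_ord _)).
(* Recording a vertex [z] by [diffset x z] turns common neighbours into balanced sets. *)
rewrite -(card_imset _ (can_inj (_ : cancel (fun W => x + indicator W)%R (diffset x)))).
  apply: eq_card => z; rewrite inE; apply/idP/imsetP.
    move=> /andP[xz yz]; exists (diffset x z).
      rewrite inE [#|_| == k]xz /=.
      suff -> : symdiff (diffset x y) (diffset x z) = diffset y z by [].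
      by apply/setP => i; rewrite in_symdiff !in_diffset addbACA addbb.
    apply: vector_ext => i; rewrite mxE Z2_add_neq0 indicator_neq0 in_diffset.
    by rewrite addKb.
  move=> [W]; rewrite inE => /andP[Wk yWk] ->.
  have xW : diffset x (x + indicator W)%R = W.
    by apply/setP => i; rewrite in_diffset mxE Z2_add_neq0 indicator_neq0 addKb.
  have yW : diffset y (x + indicator W)%R = symdiff (diffset x y) W.
    apply/setP => i; rewrite in_symdiff !in_diffset mxE Z2_add_neq0 indicator_neq0.
    by rewrite addbA [in RHS](addbC (x ord0 i != 0)%R).
  by rewrite /Omega /hamming -/(diffset _ _) -/(diffset _ _) xW yW Wk.
by move=> W; apply/setP => i; rewrite in_diffset mxE Z2_add_neq0 indicator_neq0 addKb.
Qed.

Section Automorphism.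
Variable s : {perm V}.
Hypothesis aut_s : automorphism (Omega k) s.

Lemma aut_Omega x y : Omega k (s x) (s y) = Omega k x y.
Proof. by have /forallP/(_ x)/forallP/(_ y)/eqP := aut_s. Qed.

Lemma aut_common_neighbors x y :
  #|[set z | Omega k (s x) z && Omega k (s y) z]|
  = #|[set z | Omega k x z && Omega k y z]|.
Proof.
rewrite -[RHS](card_imset _ (@perm_inj _ s)); apply: eq_card => z.
rewrite -(permKV s z) mem_imset; last exact: perm_inj.
by rewrite !inE !aut_Omega.
Qed.

Lemma aut_hamming x y : odd (hamming (s x) (s y)) = odd (hamming x y) /\
  (~~ odd (hamming x y) -> hamming (s x) (s y) = hamming x y \/
                           hamming (s x) (s y) = 2 * k - hamming x y).
Proof.
have := aut_common_neighbors x y; rewrite !common_neighbors.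
have : hamming x y <= 2 * k by exact: card_ord_le.
have : hamming (s x) (s y) <= 2 * k by exact: card_ord_le.
move: (hamming x y) (hamming (s x) (s y)) => d d' d'k dk.
(* Positivity tells even distances from odd ones, whose count is 0. *)
have pos j : j <= k -> 0 < 'C(2 * j, j) * 'C(2 * (k - j), k - j).
  by move=> jk; rewrite muln_gt0 !bin_gt0; lia.
have := pos d./2 ltac:(lia); have := pos d'./2 ltac:(lia).
case od: (odd d); case od': (odd d') => //; try lia.
by move=> _ _ /central_bin_prod_inj e; split=> // _; lia.
Qed.

Lemma aut_fold l x y (d := #|symdiff (fold l x) (fold l y)|)
    (d' := #|symdiff (fold l (s x)) (fold l (s y))|) :
  odd d' = odd d /\ (~~ odd d -> d' = d \/ d' = 2 * k - d).
Proof.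
have := aut_hamming x y; rewrite {}/d {}/d'.
have := hamming_fold l x y; have := hamming_fold l (s x) (s y).
have := card_ord_le (symdiff (fold l x) (fold l y)).
have := card_ord_le (symdiff (fold l (s x)) (fold l (s y))).
move: #|_| #|_| (hamming _ _) (hamming _ _) => a b c d *.
lia.
Qed.

End Automorphism.
End Orthogonality.

(** Colours are matched with the 2-subsets of the labels; each subset is ordered arbitrarily so that
    its labels can be dealt to two antipodes. *)
Lemma exists_unordered_pairs m : exists p : 'I_('C(m, 2)) -> 'I_m * 'I_m,
  (forall c, (p c).1 != (p c).2) /\
  (forall c c', [set (p c).1; (p c).2] = [set (p c').1; (p c').2] -> c = c').
Proof.
pose P := [set A : {set 'I_m} | #|A| == 2].
have cP : #|P| = 'C(m, 2) by rewrite card_draws card_ord.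
have [p pP] : exists p : 'I_('C(m, 2)) -> 'I_m * 'I_m, forall c,
    (p c).1 != (p c).2 /\ enum_val (cast_ord (esym cP) c) = [set (p c).1; (p c).2].
  apply: (fin_all_exists (P := fun c (u : 'I_m * 'I_m) =>
    u.1 != u.2 /\ enum_val (cast_ord (esym cP) c) = [set u.1; u.2])) => c.
  have := enum_valP (cast_ord (esym cP) c); rewrite inE => /cards2P[a [b [ab e]]].
  by exists (a, b).
exists p; split=> [c|c c']; first by case: (pP c).
by case: (pP c) (pP c') => _ <- [_ <-] /enum_val_inj /cast_ord_inj.
Qed.

(** * The lower bound, and labelings built from colourings of antipodal pairs *)

Section Bounds.
Variable k : nat.
Hypothesis k_gt0 : 0 < k.
Local Notation V := 'rV['Z_2]_(2 * k).
Implicit Types x y z : V.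
Implicit Types (l i : 'I_(2 * k)) (A : {set 'I_(2 * k)}).

Let dim_gt0 : 0 < 2 * k. Proof. by lia. Qed.
Let dim_gt1 : 1 < 2 * k. Proof. by lia. Qed.
Let l0 := Ordinal dim_gt0.
Let l1 := Ordinal dim_gt1.

Lemma not_distinguishable_le2 d : d <= 2 -> ~~ distinguishable (Omega k) d.
Proof.
move=> d2; apply/existsP => -[f /forallP f_dist].
have trivial s : automorphism (Omega k) s -> (forall x, f (s x) = f x) -> s = 1%g.
  move=> aut_s fs; apply/eqP; have /implyP := f_dist s; apply.
  by rewrite aut_s; apply/forallP => x; apply/eqP.
have aut_fold (s : {perm V}) : (forall x y, Omega k (s x) (s y) = Omega k x y) ->
    automorphism (Omega k) s.
  by move=> sO; apply/forallP => x; apply/forallP => y; apply/eqP.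
(* Exchanging two antipodes keeps every fold, hence is an automorphism. *)
have f_antipode x : f (antipode x) != f x.
  apply/eqP => fx; pose s := tperm x (antipode x).
  have sF y : fold l0 (s y) = fold l0 y.
    by rewrite /s; case: tpermP => [->|->|]; rewrite ?fold_antipode.
  have : s x = x.
    rewrite (trivial s) ?perm1 //.
      by apply: aut_fold => y z; rewrite !(Omega_fold l0) !sF.
    by move=> y; rewrite /s; case: tpermP => [->|->|].
  by move/eqP; rewrite tpermL; apply/negP; exact: (antipode_neq_self l0).
(* Since [l1] differs from [l0], translation by [e] moves every antipodal pair. *)
pose e : V := indicator [set l1].
have ee x : (x + e + e)%R = x.
  by apply: vector_ext => i; rewrite !mxE !Z2_add_neq0; do 2!case: (_ != _).
(* If the translation changes the label, the antipode of [x + e] has the label of [x], as only two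
   labels are available. *)
pose t x := if f (x + e)%R == f x then (x + e)%R else antipode (x + e)%R.
have f_t x : f (t x) = f x.
  rewrite /t; case: eqP => // fx; have := f_antipode (x + e)%R; apply: contraNeq.
  move: fx; move: (f (antipode _)) (f (x + e)%R) (f x) => a b c bc ac.
  have {}bc : nat_of_ord b <> c by move/val_inj.
  have {}ac : nat_of_ord a <> c by move/val_inj/eqP; apply/negP.
  apply/eqP/val_inj => /=; have := ltn_ord a; have := ltn_ord b; have := ltn_ord c; lia.
have tK : involutive t.
  move=> x; have := f_t x; rewrite [t x]/t; case: eqP => fx ft.
    by rewrite /t ee fx eqxx.
  by rewrite /t ft -antipode_translate ee (negbTE (f_antipode x)) antipodeK.
have tF x : fold l0 (t x) = fold l0 (x + e)%R.
  by rewrite /t; case: ifP; rewrite ?fold_antipode.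
have t0 : t 0%R = 0%R.
  have := trivial (perm (inv_inj tK)); move/(_ _ _)/permP/(_ 0%R).
  rewrite perm1 permE; apply => [|x]; last by rewrite permE.
  apply: aut_fold => x y; rewrite !permE (Omega_fold l0) !tF -Omega_fold.
  by rewrite /Omega hamming_translate.
have := tF 0%R; rewrite t0 add0r => /setP/(_ l1); rewrite !in_fold !indicator_neq0 !inE.
by rewrite !mxE.
Qed.

(** The images are at fold distance 0 or 2 k, and 2 k is impossible because [l] lies in neither
    fold. *)
Lemma aut_fold_eq l (s : {perm V}) x y : automorphism (Omega k) s ->
  fold l x = fold l y -> fold l (s x) = fold l (s y).
Proof.
move=> aut_s exy; have [_] := aut_fold aut_s l x y.
rewrite exy (eqP (_ : #|symdiff _ _| == 0)) ?card_symdiff_eq0 // => /(_ isT) h.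
apply/eqP; rewrite -card_symdiff_eq0.
have := cardsC (symdiff (fold l (s x)) (fold l (s y))); rewrite card_ord.
have : 0 < #|~: symdiff (fold l (s x)) (fold l (s y))|.
  by apply/card_gt0P; exists l; rewrite in_setC in_symdiff !(negbTE (notin_fold _ _)).
by move: h; move: #|_| #|_| => a b; lia.
Qed.

(** Such [x] and [y] have as many common neighbours as [x] has with itself, so their distance is 0
    or 2 k. *)
Lemma fold_eq_neighbors l x y :
  (forall z, Omega k x z = Omega k y z) -> fold l x = fold l y.
Proof.
move=> exy; have : #|[set z | Omega k x z && Omega k x z]|
    = #|[set z | Omega k x z && Omega k y z]|.
  by apply: eq_card => z; rewrite !inE exy.
have hxx : hamming x x = 0.
  by apply/eqP; rewrite cards_eq0; apply/eqP/setP=> i; rewrite !inE eqxx.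
rewrite !common_neighbors hxx /=.
have hk : hamming x y <= 2 * k by exact: card_ord_le.
have pos : 0 < 'C(2 * 0, 0) * 'C(2 * (k - 0), k - 0) by rewrite muln_gt0 !bin_gt0; lia.
case: ifP => oh; first by move: pos => /[swap] ->.
move/central_bin_prod_inj => e.
apply/eqP; rewrite -card_symdiff_eq0.
have := cardsC (symdiff (fold l x) (fold l y)); rewrite card_ord.
have : 0 < #|~: symdiff (fold l x) (fold l y)|.
  by apply/card_gt0P; exists l; rewrite in_setC in_symdiff !(negbTE (notin_fold _ _)).
have := hamming_fold l x y; move: #|_| #|_| (hamming _ _) hk oh e => a b h; lia.
Qed.

(** The entry at [l] decides which antipode gets which label of the pair. A label-preserving
    automorphism respects antipodal pairs, hence their colours; it then fixes every pair and, the
    two labels being distinct, each vertex. *)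
Lemma distinguishable_of_colouring m l (c : {set 'I_(2 * k)} -> nat) :
  (forall x, c (fold l x) < 'C(m, 2)) ->
  (forall s : {perm V}, automorphism (Omega k) s ->
     (forall x, c (fold l (s x)) = c (fold l x)) ->
     forall x, fold l (s x) = fold l x) ->
  distinguishable (Omega k) m.
Proof.
move=> c_lt rigid; have [p [p_neq p_inj]] := exists_unordered_pairs m.
pose q x := p (Ordinal (c_lt x)).
have qE x y : fold l x = fold l y -> q x = q y.
  by move=> e; rewrite /q; congr p; apply: val_inj; rewrite /= e.
pose f := [ffun x : V => if x ord0 l != 0%R then (q x).2 else (q x).1].
have fE x : [set f x; f (antipode x)] = [set (q x).1; (q x).2].
  rewrite !ffunE antipode_neq (qE (antipode x) x) ?fold_antipode //.
  by case: ifP => //= _; rewrite setUC.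
have f_antipode x : f (antipode x) != f x.
  rewrite !ffunE antipode_neq (qE (antipode x) x) ?fold_antipode //.
  have : (q x).1 != (q x).2 by exact: p_neq.
  by case: (_ != 0%R) => //=; rewrite eq_sym.
apply/existsP; exists f; apply/forallP => s; apply/implyP => /andP[aut_s /forallP fs].
have s_antipode x : s (antipode x) = antipode (s x).
  have [//|/perm_inj e] : s (antipode x) = antipode (s x) \/ s (antipode x) = s x.
    by rewrite or_comm; apply: (@fold_inj _ l); apply: aut_fold_eq; rewrite ?fold_antipode.
  by have := antipode_neq_self l x; rewrite e eqxx.
have sF : forall x, fold l (s x) = fold l x.
  apply: rigid => // x; have := fE (s x).
  by rewrite -s_antipode (eqP (fs _)) (eqP (fs _)) fE => /p_inj/(congr1 val).
apply/eqP/permP => x; rewrite perm1; have [//|e] := fold_inj (esym (sF x)).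
by have := fs x; rewrite e (negbTE (f_antipode x)).
Qed.

(** The sums run over singletons and read off their element. A fold avoids [l0], whose value is 0,
    so private colours are 1, ..., 2 k - 1. The spare colour is 0, except for odd folds with [k]
    even, where it is 2 k. *)
Definition colour (A : {set 'I_(2 * k)}) : nat :=
  if odd #|A| then
    if (#|A| == 1) && (~~ odd k || (l1 \notin A)) then \sum_(i in A) val i
    else if odd k then 0 else 2 * k
  else if #|setC_off l0 A| == 1 then \sum_(i in setC_off l0 A) val i else 0.

Lemma colour_lt A : colour A < threshold k.
Proof.
have sum1 (B : {set 'I_(2 * k)}) : #|B| == 1 -> \sum_(i in B) val i < 2 * k.
  by case/cards1P => i ->; rewrite big_set1 ltn_ord.
rewrite /colour /threshold; case: (odd #|A|).
  case: ifP => [/andP[/sum1 lt _]|_]; case: (odd k); lia.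
case: ifP => [/sum1 lt|_]; last by case: (odd k); lia.
by apply: leq_trans lt _; case: (odd k); lia.
Qed.

Lemma ord_gt0 (i : 'I_(2 * k)) : i != l0 -> 0 < i.
Proof. by rewrite -val_eqE /= lt0n. Qed.

Lemma notin_set1 i : i != l0 -> l0 \notin [set i].
Proof. by rewrite inE eq_sym. Qed.

Lemma even_card_setC_off1 i : i != l0 -> ~~ odd #|setC_off l0 [set i]|.
Proof. by move/notin_set1=> li; rewrite card_setC_off // card_ord cards1; lia. Qed.

Lemma colour_setC_off1 i : i != l0 -> colour (setC_off l0 [set i]) = i.
Proof.
move=> il; rewrite /colour (negbTE (even_card_setC_off1 il)).
by rewrite setC_offK ?notin_set1 // cards1 big_set1.
Qed.

Lemma colour_set1 i : ~~ odd k || (i != l1) -> colour [set i] = i.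
Proof.
by move=> ki; rewrite /colour cards1 /= inE [l1 == i]eq_sym ki big_set1.
Qed.

(** A private colour may be shared by an even and an odd fold, so parity has to be known before the
    colour identifies the fold. *)
Lemma colour_even_eq i A : i != l0 -> l0 \notin A -> ~~ odd #|A| ->
  colour A = i -> A = setC_off l0 [set i].
Proof.
move=> il lA oA; rewrite /colour (negbTE oA).
case: ifP => [/cards1P[j Aj]|_ i0]; last by have := ord_gt0 il; rewrite -i0.
by rewrite Aj big_set1 => /val_inj <-; rewrite -Aj setC_offK.
Qed.

Lemma colour_odd_eq i A : i != l0 -> odd #|A| -> colour A = i -> A = [set i].
Proof.
move=> il oA; rewrite /colour oA.
case: ifP => [/andP[/cards1P[j ->] _]|_]; first by rewrite big_set1 => /val_inj ->.
by have := ord_gt0 il; have := ltn_ord i; case: (odd k); lia.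
Qed.

(** * Rigidity of the colouring *)

Section Rigidity.
Variable s : {perm V}.
Hypothesis aut_s : automorphism (Omega k) s.
Hypothesis colour_s : forall x, colour (fold l0 (s x)) = colour (fold l0 x).
Local Notation F := (fold l0).

Let FI A : l0 \notin A -> F (indicator A) = A. Proof. exact: fold_indicator. Qed.

(** For [k] odd, colour [l1] occurs on no odd fold, as [[set l1]] has colour 0. For [k] even, the
    empty fold has colour 0, which no odd fold has. *)
Lemma exists_parity_witness : exists x, odd #|F (s x)| = odd #|F x|.
Proof.
case k_odd: (odd k).
  have l10 : l1 != l0 by [].
  pose x := indicator (setC_off l0 [set l1]).
  have Fx : F x = setC_off l0 [set l1] by rewrite FI ?notin_setC_off.
  exists x; rewrite Fx (negbTE (even_card_setC_off1 l10)); apply/negbTE/negP => osx.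
  have := colour_s x; rewrite Fx colour_setC_off1 // => cx.
  move: cx (colour_odd_eq l10 osx cx) => /[swap] ->.
  by rewrite /colour cards1 inE eqxx k_odd.
pose x := indicator (set0 : {set 'I_(2 * k)}).
have Fx : F x = set0 by rewrite FI ?inE.
exists x; rewrite Fx cards0; apply/negbTE/negP => osx.
have := colour_s x.
rewrite Fx /colour osx cards0 card_setC_off ?inE // card_ord cards0 k_odd /=.
(* Equality would mean [k = 1], but here [k] is even. *)
rewrite (_ : (2 * k - 0).-1 == 1 = false); last by lia.
case: ifP => [/andP[/cards1P[j Fj]]|]; last by lia.
rewrite Fj big_set1 => _ j0; have := notin_fold l0 (s x).
by rewrite Fj inE -val_eqE /= j0.
Qed.

Lemma aut_parity x : odd #|F (s x)| = odd #|F x|.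
Proof.
have [x0 e0] := exists_parity_witness; have [] := aut_fold aut_s l0 x x0.
by rewrite !odd_card_symdiff e0 => /addIb.
Qed.

Lemma fixed_setC_off i x : i != l0 -> F x = setC_off l0 [set i] -> F (s x) = F x.
Proof.
move=> il Fx; rewrite Fx; apply: colour_even_eq => //; first exact: notin_fold.
  by rewrite aut_parity Fx even_card_setC_off1.
by rewrite colour_s Fx colour_setC_off1.
Qed.

Lemma fixed_set1 i x : i != l0 -> ~~ odd k || (i != l1) ->
  F x = [set i] -> F (s x) = F x.
Proof.
move=> il ki Fx; rewrite Fx; apply: colour_odd_eq => //.
  by rewrite aut_parity Fx cards1.
by rewrite colour_s Fx colour_set1.
Qed.

Lemma fixed_even x : ~~ odd #|F x| -> F (s x) = F x.
Proof.
move=> ox; have osx : ~~ odd #|F (s x)| by rewrite aut_parity.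
have lF y : l0 \notin F y by exact: notin_fold.
have cF y : #|setC_off l0 (F y)| = (2 * k - #|F y|).-1 by rewrite card_setC_off ?card_ord.
have lt y : #|F y| < 2 * k.
  rewrite -[ltnRHS]card_ord -cardsT proper_card // properT.
  by apply: contraNneq (lF y) => ->; rewrite inE.
(* The complements are odd, and the even folds with private colours are already fixed. *)
have := @resolved_by_singletons _ k l0 (setC_off l0 (F x)) (setC_off l0 (F (s x))).
rewrite card_ord !notin_setC_off !cF => /(_ erefl isT isT).
case.
- have := lt x; lia.
- have := lt (s x); lia.
- move=> i il; pose u : V := indicator (setC_off l0 [set i]).
  have Fu : F u = setC_off l0 [set i] by rewrite FI ?notin_setC_off.
  rewrite -!symdiff_setC_off // -Fu -{1 3}(fixed_setC_off il Fu).
  have [_] := aut_fold aut_s l0 x u; apply.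
  by rewrite odd_card_symdiff (negbTE ox) Fu (negbTE (even_card_setC_off1 il)).
- by move/(congr1 (setC_off l0)); rewrite !setC_offK // => ->.
(* Complements of size [k] or [(2 * k).-1] mean folds of size [k.-1] or 0. *)
move=> [k_odd cx csx]; apply/esym; apply: (@resolved_by_adjacency _ k l0 l1) => //.
- by rewrite card_ord.
- have := lt x; lia.
- have := lt (s x); lia.
move=> i il il1; pose u : V := indicator [set i].
have Fu : F u = [set i] by rewrite FI ?notin_set1.
have Fsu : F (s u) = [set i] by rewrite (fixed_set1 (i := i)) // il1 orbT.
by rewrite -{1}Fu -Fsu -!Omega_fold aut_Omega.
Qed.

Lemma colour_rigid x : F (s x) = F x.
Proof.
case ox: (odd #|F x|); last by apply: fixed_even; rewrite ox.
have osx : odd #|F (s x)| by rewrite aut_parity.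
case k_odd: (odd k).
  (* Two odd folds are at even distance, hence not adjacent for [k] odd; even folds are fixed, so
     adjacency to them is unchanged. *)
  apply: fold_eq_neighbors => z; rewrite (Omega_fold l0).
  case oz: (odd #|F z|).
    have := odd_card_symdiff (F (s x)) (F z); have := odd_card_symdiff (F x) (F z).
    rewrite ox osx oz !(Omega_fold l0); move: #|_| #|_| => a b; lia.
  rewrite -(fixed_even (x := z)) ?oz // -Omega_fold aut_Omega //.
(* For [k] even there are no exceptional sizes, and all singletons other than [[set l0]] are
   fixed. *)
have := @resolved_by_singletons _ k l0 (F x) (F (s x)).
rewrite card_ord !notin_fold k_odd => /(_ erefl isT isT ox osx).
case=> [i il|->|[]] //.
pose u : V := indicator [set i].
have Fu : F u = [set i] by rewrite FI ?notin_set1.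
have Fsu : F (s u) = [set i] by rewrite (fixed_set1 (i := i)) // k_odd.
have [_] := aut_fold aut_s l0 x u; rewrite Fu Fsu; apply.
by rewrite odd_card_symdiff ox cards1.
Qed.

End Rigidity.

End Bounds.

Theorem theorem4 (k m : nat) :
  1 <= k ->
  threshold k <= 'C(m, 2) ->
  (forall n : nat, threshold k <= 'C(n, 2) -> m <= n) ->
  2 < Dist (Omega k) /\ Dist (Omega k) <= m.
Proof.
move=> k_gt0 km _; rewrite /Dist; case: ex_minnP => d dist_d min_d; split.
  by rewrite ltnNge; apply: contraL dist_d => /(not_distinguishable_le2 k_gt0).
apply: min_d; apply: (@distinguishable_of_colouring k k_gt0 m _ (colour k_gt0)).
  by move=> x; apply: leq_trans km; apply: colour_lt.
by move=> s aut_s cs x; apply: colour_rigid.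
Qed.
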